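(* Let $\varepsilon<1/2$ and $\delta\le 1/6$. Any (possibly randomized and adaptive) algorithm that, for every Boolean formula $\phi$ over $n$ variables, outputs an $(\varepsilon,\delta)$-approximation of $|\mathrm{sol}(\phi)|$ using only queries to a SAT-Sample oracle in the query model described below must make $\tilde{\Omega}(\log n)$ queries to the SAT-Sample oracle, where the tilde hides a factor of $\log\log n$ (i.e. the bound is $\Omega(\log n/\log\log n)$).
   Context: For a Boolean formula $\phi$ over variables $v_1,\dots,v_n$, $\mathrm{sol}(\phi)\subseteq\{T,F\}^n$ denotes its set of satisfying assignments. An estimate $\mathsf{Est}$ is an $(\varepsilon,\delta)$-approximation of $|\mathrm{sol}(\phi)|$ if $\Pr\left[\frac{|\mathrm{sol}(\phi)|}{1+\varepsilon}\le \mathsf{Est}\le (1+\varepsilon)|\mathrm{sol}(\phi)|\right]\ge 1-\delta$. A SAT-Sample oracle takes a Boolean formula as input and, if it is satisfiable, returns a satisfying assignment chosen uniformly at random from its set of satisfying assignments, and returns $\bot$ otherwise. Query model: for any set $A\subseteq\{T,F\}^n$ let $\psi_A$ be a formula with $\mathrm{sol}(\psi_A)=A$; the algorithm accesses the input $\phi$ only by querying the oracle on formulas $\phi_A:=\phi\wedge\psi_A$ for arbitrary (adaptively chosen) sets $A$. *)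

(* Defs.v *)
From HB Require Import structures.
From mathcomp Require Import all_boot all_order all_algebra.
From mathcomp Require Import all_classical all_reals all_analysis.
Set Implicit Arguments.
Unset Strict Implicit.
Unset Printing Implicit Defensive.
Import Order.TTheory GRing.Theory Num.Theory.
Import numFieldNormedType.Exports.
Local Open Scope ring_scope.

Definition assignment (n : nat) := {ffun 'I_n -> bool}.

Inductive formula (n : nat) : Type :=
| FConst of bool
| FVar of 'I_n
| FNot of formula n
| FAnd of formula n & formula n
| FOr of formula n & formula n.

Arguments FConst {n} _.

Fixpoint sat (n : nat) (v : assignment n) (phi : formula n) : bool :=
  match phi with
  | FConst b => b
  | FVar i => v i
  | FNot f => ~~ sat v f
  | FAnd f g => sat v f && sat v g
  | FOr f g => sat v f || sat v g
  end.

Definition sol (n : nat) (phi : formula n) : {set assignment n} :=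
  [set v | sat v phi]%SET.

(* [psi A] is the full DNF of A: one minterm for each assignment in A. *)
Definition minterm (n : nat) (a : assignment n) : formula n :=
  foldr (@FAnd n) (FConst true)
    [seq (if a i then FVar i else FNot (FVar i)) | i <- enum 'I_n].

Definition psi (n : nat) (A : {set assignment n}) : formula n :=
  foldr (@FOr n) (FConst false) [seq minterm a | a <- enum A].

Lemma sat_minterm (n : nat) (v a : assignment n) : sat v (minterm a) = (v == a).
Proof.
have E s : sat v (foldr (@FAnd n) (FConst true)
    [seq (if a i then FVar i else FNot (FVar i)) | i <- s])
    = all (fun i => v i == a i) s.
  elim: s => //= i s ->; congr (_ && _).
  by case: (a i) => /=; case: (v i).
rewrite /minterm E; apply/allP/eqP => [H|-> //].
by apply/ffunP => i; apply/eqP/H; rewrite mem_enum.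
Qed.

Lemma sol_psi (n : nat) (A : {set assignment n}) : sol (psi A) = A.
Proof.
have E v s : sat v (foldr (@FOr n) (FConst false) [seq minterm a | a <- s])
    = (v \in s).
  by elim: s => //= a s ->; rewrite sat_minterm inE.
by apply/setP => v; rewrite inE /psi E mem_enum.
Qed.

(* Probability that the SAT-Sample oracle, called on phi, answers a; the answer
   [None] is bottom. *)
Definition sat_sample (R : realType) (n : nat) (phi : formula n)
    (a : option (assignment n)) : R :=
  match a with
  | None => (sol phi == finset.set0)%:R
  | Some v => (v \in sol phi)%:R / #|sol phi|%:R
  end.

Lemma sat_sample_sum1 (R : realType) (n : nat) (phi : formula n) :
  \sum_a sat_sample R phi a = 1.
Proof.
rewrite (bigD1 None) //= (reindex_omap Some id) /=; last by case.
rewrite (eq_bigl xpredT); last by move=> v; rewrite /= eqxx.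
rewrite -mulr_suml -natr_sum -big_mkcond /= sum1_card.
have [->|phi0] := eqVneq (sol phi) finset.set0.
  by rewrite cards0 mul0r addr0.
by rewrite add0r divff // pnatr_eq0 cards_eq0.
Qed.

(* A deterministic adaptive strategy.  [Query A k] calls the oracle on
   phi /\ psi_A, where phi is the unknown input, and goes on with [k a] when
   the answer is a. *)
Inductive strategy (R : realType) (n : nat) : Type :=
| Output of R
| Query of {set assignment n} & (option (assignment n) -> strategy R n).

(* Probability, over the independent oracle answers, that the strategy run on
   phi outputs an estimate in B. *)
Fixpoint output_prob (R : realType) (n : nat) (phi : formula n) (B : set R)
    (t : strategy R n) : R :=
  match t with
  | Output e => \1_B e
  | Query A k => \sum_(a : option (assignment n))
      sat_sample R (FAnd phi (psi A)) a * output_prob phi B (k a)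
  end.

(* Largest number of queries made on input phi, over all the sequences of
   oracle answers that have positive probability. *)
Fixpoint num_queries (R : realType) (n : nat) (phi : formula n)
    (t : strategy R n) : nat :=
  match t with
  | Output _ => 0
  | Query A k =>
      (\max_(a : option (assignment n) | 0 < sat_sample R (FAnd phi (psi A)) a)
        num_queries phi (k a)).+1
  end.

(* All the internal randomness is drawn first, from an arbitrary probability
   space; the measurability condition says that the law of the output on each
   input is a measurable function of it. *)
Record algorithm (R : realType) (n : nat) := Algorithm {
  seed_display : measure_display ;
  seed : measurableType seed_display ;
  seed_law : probability seed R ;
  run : seed -> strategy R n ;
  measurable_run : forall (phi : formula n) (B : set R), measurable B ->
    measurable_fun [set: seed] (fun w => output_prob phi B (run w))
}.

Definition estimate_prob (R : realType) (n : nat) (M : algorithm R n)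
    (phi : formula n) (B : set R) : \bar R :=
  (\int[seed_law M]_w (output_prob phi B (run w))%:E)%E.

Definition approximates (R : realType) (n : nat) (M : algorithm R n)
    (eps delta : R) (phi : formula n) : Prop :=
  ((1 - delta)%:E <=
   estimate_prob M phi
     [set e : R | (#|sol phi|%:R / (1 + eps) <= e <= (1 + eps) * #|sol phi|%:R)%R]%classic)%E.

Definition query_bound (R : realType) (n : nat) (M : algorithm R n) (q : nat) :
    Prop :=
  forall (phi : formula n) (w : seed M), (num_queries phi (run w) <= q)%N.

(* Main.v *)
Require Import Defs.
From HB Require Import structures.
From mathcomp Require Import all_boot all_order all_algebra.
From mathcomp Require Import all_classical all_reals all_analysis.
From mathcomp Require Import measurable_realfun ring lra zify.
Set Implicit Arguments.
Unset Strict Implicit.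
Unset Printing Implicit Defensive.
Import Order.TTheory GRing.Theory Num.Theory.
Import numFieldNormedType.Exports.
Import mathcomp.boot.fintype mathcomp.boot.finset.
Local Open Scope ring_scope.

(* The hard inputs are uniformly random solution sets of size [2 ^ e] or
   [2 ^ (e + 2)], whose approximation intervals are disjoint, for [K] well
   separated values of [e].  Let [F] be the set of solutions seen so far.  A
   query [A] whose fresh part [A :\: F] is much larger than [2 ^ (n - e)] is
   almost surely answered by an almost uniform fresh element, and one whose
   fresh part is much smaller by a uniform element of [A :&: F], or by bottom;
   in both cases the answer does not tell the two sizes apart.  So a correct
   algorithm must, for most values of [e], make a query whose fresh part has
   size close to [2 ^ (n - e)].  A fresh part is that close for at most one
   [e], and every query splits the values of [e] into two groups, those for
   which it is large and those for which it is small.  So [q] queries serve at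
   most [2 ^ q] values of [e], up to small errors, and [q] is at least of order
   [log n]. *)

(** * Elementary inequalities *)

Lemma prod_inv_ge (R : realType) (I : eqType) (r : seq I) (y : I -> R) :
  {in r, forall i, 0 < y i} ->
  1 - \sum_(i <- r) (y i - 1) <= \prod_(i <- r) (y i)^-1.
Proof.
(* [1 + x <= expR x] is used twice: on each factor, as [(y i)^-1 >= expR (1 - y i)], and on the
   exponential of the resulting sum. *)
move=> y_gt0; apply: (@le_trans _ _ (expR (- \sum_(i <- r) (y i - 1)))).
  exact: expR_ge1Dx.
rewrite expRN expR_sum -prodfV big_seq [leRHS]big_seq.
apply: ler_prod => i ir.
rewrite invr_ge0 expR_ge0 lef_pV2 ?posrE ?expR_gt0 ?y_gt0 //.
by apply: le_trans (expR_ge1Dx _); rewrite addrC subrK.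
Qed.

Lemma bernoulli_ineq (R : realType) (x : R) (m : nat) :
  0 <= x <= 1 -> 1 - m%:R * x <= (1 - x) ^+ m.
Proof.
move=> /andP[x0 x1]; elim: m => [|m IH]; first by rewrite mul0r subr0 expr0.
rewrite exprS; apply: le_trans (ler_wpM2l _ IH); last by rewrite subr_ge0.
rewrite -natr1; have : 0 <= m%:R * x * x by rewrite !mulr_ge0.
by lra.
Qed.

(** * Counting the sets of size [s] that contain [F] *)

Section Supersets.
Variables (R : realType) (T : finType).
Implicit Types (F S : {set T}) (s q : nat).

Definition nsup s F := #|[set S : {set T} | (F \subset S) && (#|S| == s)]%SET|.

Lemma nsupE s F : (#|F| <= s)%N -> nsup s F = 'C(#|T| - #|F|, s - #|F|).
Proof.
move=> Fs; have -> : (#|T| - #|F|)%N = #|~: F|.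
  by rewrite -(cardsC F) addKn.
rewrite -cards_draws /nsup.
rewrite -[RHS](card_in_imset (f := fun S => F :|: S)).
  apply: eq_card => S; rewrite !inE; apply/andP/imsetP.
    move=> [FS /eqP <-]; exists (S :\: F).
      rewrite inE cardsD (setIidPr FS) eqxx andbT.
      by apply/subsetP => x; rewrite !inE => /andP[].
    apply/setP => x; rewrite !inE; by have [/(subsetP FS) ->|_] := boolP (x \in F).
  move=> [S']; rewrite inE => /andP[S'F /eqP cS'] ->.
  rewrite subsetUl; split => //.
  rewrite cardsU cS' (_ : F :&: S' = set0) ?cards0 ?subn0 ?subnKC //.
  by apply/eqP; rewrite setI_eq0 disjoint_sym disjoints_subset.
move=> S1 S2; rewrite !inE => /andP[S1F _] /andP[S2F _] /setP E.
apply/setP => x; have := E x; rewrite !inE.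
have [xF _|//] := boolP (x \in F).
have notin (S : {set T}) : S \subset ~: F -> (x \in S) = false.
  by move=> /subsetP SF; apply/negP => /SF; rewrite inE xF.
by rewrite !notin.
Qed.

Lemma nsup0 s : nsup s set0 = 'C(#|T|, s).
Proof. by rewrite nsupE cards0 ?subn0. Qed.

Lemma nsupU1 s F x : x \notin F -> (#|F| < s)%N ->
  (nsup s (x |: F) * (#|T| - #|F|) = nsup s F * (s - #|F|))%N.
Proof.
move=> xF Fs; rewrite !nsupE ?cardsU1 ?xF // 1?ltnW //.
have := mul_bin_diag (#|T| - #|F|) (s - #|F|).-1.
rewrite prednK ?subn_gt0 // => H.
by rewrite add1n !subnS mulnC H mulnC.
Qed.

(** The exact ratio is [(s - #|F|) / (#|T| - #|F|)], and subtracting the same amount from both terms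
    of a fraction at most 1 cannot raise it. *)
Lemma nsupU1_le s F x : x \notin F -> (#|F| < s)%N -> (s <= #|T|)%N ->
  (nsup s (x |: F))%:R <= s%:R / #|T|%:R * (nsup s F)%:R :> R.
Proof.
move=> xF Fs sT; have T0 : 0 < #|T|%:R :> R by rewrite ltr0n; lia.
rewrite mulrAC ler_pdivlMr // -!natrM ler_nat.
have := nsupU1 xF Fs; set a := nsup _ _; set b := nsup _ _ => E.
have : (a * (#|T| - #|F|) * #|T| <= s * b * (#|T| - #|F|))%N.
  rewrite E -mulnA [(s * b)%N]mulnC -mulnA leq_mul2l; apply/orP; right.
  by rewrite mulnBl mulnBr leq_sub2l // [(s * _)%N]mulnC leq_mul2l sT orbT.
rewrite mulnAC leq_pmul2r //; lia.
Qed.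

(** The elements of [F] are removed one at a time; each contributes a ratio of at least
    [(s - q) / #|T|]. *)
Lemma nsup_ge s q F : (#|F| <= q)%N -> (q < s)%N -> (s <= #|T|)%N ->
  ((s - q)%:R / #|T|%:R) ^+ #|F| * 'C(#|T|, s)%:R <= (nsup s F)%:R :> R.
Proof.
move=> Fq qs sT; have T0 : 0 < #|T|%:R :> R by rewrite ltr0n; lia.
have [m] := ubnP #|F|; elim: m F Fq => // m IH F Fq.
have [->|/set0Pn[x xF]] := eqVneq F set0.
  by rewrite cards0 expr0 mul1r nsup0.
have xFx : x \notin F :\ x by rewrite !inE eqxx.
have cF := cardsD1 x F; rewrite xF add1n in cF; rewrite cF ltnS => Fm.
have IHx := IH (F :\ x) ltac:(lia) Fm.
have Fs : (#|F :\ x| < s)%N by lia.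
have := nsupU1 xFx Fs; rewrite setD1K // => E.
rewrite exprS -mulrA; apply: le_trans (ler_wpM2l _ IHx) _.
  by rewrite divr_ge0.
rewrite mulrAC ler_pdivrMr // -!natrM ler_nat.
apply: (@leq_trans (nsup s (F :\ x) * (s - #|F :\ x|))).
  by rewrite mulnC leq_mul2l; apply/orP; right; lia.
by rewrite -E leq_mul2l leq_subr orbT.
Qed.

(** Double counting of the pairs [(S, x)] with [x] in [S :&: A]; it reduces first moments over the
    supersets of [F] to [nsupU1_le]. *)
Lemma sum_card_setI_sup s F A :
  \sum_(S : {set T} | (F \subset S) && (#|S| == s)) #|S :&: A|%:R
  = \sum_(x in A) (nsup s (x |: F))%:R :> R.
Proof.
rewrite -!natr_sum; congr (_%:R).
under eq_bigr => S _ do rewrite -sum1_card.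
rewrite (exchange_big_dep (mem A)) /=; last by move=> S x _; rewrite inE => /andP[].
apply: eq_bigr => x xA; rewrite sum1_card; apply: eq_card => S.
by rewrite unfold_in /= !inE xA andbT subUset sub1set andbC andbA.
Qed.

End Supersets.

(** * The likelihood of a history, averaged over solution sets of one size *)

Section Weight.
Variables (R : realType) (T : finType) (q : nat).
Implicit Types (F E S : {set T}) (L : seq {set T}) (s : nat).

(* Up to a constant, a lower bound for the likelihood of a history when the
   solution set is [S]: [F] is the set of answers, [E] the union of the fresh
   parts of the queries that returned no fresh element, and [L] the list of the
   fresh parts of the other queries.  At most [q] known elements add to such a
   fresh part, hence the term [q.+1], which also keeps the sum nonzero. *)
Definition weight F E L S : R :=
  (F \subset S)%:R * [disjoint E & S]%:R
  * \prod_(A <- L) (q.+1%:R + #|S :&: A|%:R)^-1.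

Lemma weight_ge0 F E L S : 0 <= weight F E L S.
Proof.
by rewrite /weight !mulr_ge0 // prodr_ge0.
Qed.

Lemma prod_card_inv_ge0 L : 0 <= \prod_(A <- L) #|A|%:R^-1 :> R.
Proof. by apply: prodr_ge0 => A _; rewrite invr_ge0. Qed.

(** If [E] misses [S], this is [prod_inv_ge] for the ratios [(q.+1 + #|S :&: A|) / (p * #|A|)].
    Otherwise the weight is 0, and the coefficient [1 + size L] makes the bracket nonpositive,
    because the sum is at least [- size L]. *)
Lemma weight_ge (p : R) F E L S : 0 < p ->
  {in L, forall A : {set T}, (0 < #|A|)%N} ->
  F \subset S ->
  \prod_(A <- L) (p * #|A|%:R)^-1
  * (1 - (1 + (size L)%:R) * #|S :&: E|%:R
     - \sum_(A <- L) ((q.+1%:R + #|S :&: A|%:R) / (p * #|A|%:R) - 1))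
  <= weight F E L S.
Proof.
move=> p0 L0 FS; rewrite /weight FS mul1r.
have y_gt0 : {in L, forall A : {set T},
    0 < (q.+1%:R + #|S :&: A|%:R) / (p * #|A|%:R) :> R}.
  by move=> A /L0 A0; rewrite divr_gt0 ?mulr_gt0 ?ltr0n // ltr_wpDr.
have [ES|/negP ES] := boolP [disjoint E & S].
  rewrite mul1r (_ : S :&: E = set0) ?cards0 ?mulr0 ?subr0; last first.
    by apply/eqP; rewrite setI_eq0 disjoint_sym.
  have -> : \prod_(A <- L) (q.+1%:R + #|S :&: A|%:R)^-1 =
      \prod_(A <- L) (p * #|A|%:R)^-1 *
      \prod_(A <- L) ((q.+1%:R + #|S :&: A|%:R) / (p * #|A|%:R))^-1 :> R.
    rewrite -big_split /= big_seq [RHS]big_seq; apply: eq_bigr => A /L0 A0.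
    rewrite invf_div mulrA mulVf ?mul1r //.
    by rewrite mulf_neq0 ?gt_eqF ?ltr0n.
  rewrite ler_wpM2l ?prod_inv_ge //.
  by apply: prodr_ge0 => A _; rewrite invr_ge0 mulr_ge0 // ltW.
rewrite mul0r mulr_ge0_le0 //.
  by apply: prodr_ge0 => A _; rewrite invr_ge0 mulr_ge0 // ltW.
have SE : 1 <= #|S :&: E|%:R :> R.
  rewrite ler1n card_gt0; apply/negP => /eqP SE; apply: ES.
  by rewrite disjoint_sym -setI_eq0 SE.
have : - (size L)%:R <= \sum_(A <- L)
    ((q.+1%:R + #|S :&: A|%:R) / (p * #|A|%:R) - 1) :> R.
  have -> : - (size L)%:R = \sum_(A <- L) (-1) :> R.
    by rewrite big_const_seq count_predT iter_addr_0 mulNrn.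
  rewrite big_seq [leRHS]big_seq; apply: ler_sum => A AL.
  by rewrite lerDr ltW ?y_gt0.
have : (1 + (size L)%:R) * 1 <= (1 + (size L)%:R) * #|S :&: E|%:R :> R.
  by rewrite ler_wpM2l // addr_ge0.
by lra.
Qed.

(* Only first moments of [#|S :&: E|] and [#|S :&: A|] are needed, because
   [weight_ge] is linear in them. *)
Lemma sum_weight_ge s Tl F E L (p := s%:R / #|T|%:R : R) :
    #|F| = size L -> (size L <= q)%N -> (q < s)%N -> (s <= #|T|)%N ->
    [disjoint F & E] -> (0 < Tl)%N -> {in L, forall A : {set T}, (Tl <= #|A|)%N} ->
    0 <= 1 - (1 + q%:R) * (p * #|E|%:R)
         - q%:R * ((q + q.+1)%:R / (p * Tl%:R)) ->
  (1 - q%:R * (q%:R / s%:R)) *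
  (1 - (1 + q%:R) * (p * #|E|%:R) - q%:R * ((q + q.+1)%:R / (p * Tl%:R))) *
  \prod_(A <- L) #|A|%:R^-1
  <= (\sum_(S : {set T} | #|S| == s) weight F E L S) / 'C(#|T|, s)%:R.
Proof.
move=> FL Lq qs sT FE Tl0 TlL; set b := 1 - _ - _ => b0.
have s0 : 0 < s%:R :> R by rewrite ltr0n; lia.
have T0 : 0 < #|T|%:R :> R by rewrite ltr0n; lia.
have p0 : 0 < p by rewrite divr_gt0.
have C0 : 0 < 'C(#|T|, s)%:R :> R by rewrite ltr0n bin_gt0.
have L0 : {in L, forall A : {set T}, (0 < #|A|)%N}.
  by move=> A /TlL; apply: leq_trans.
have Fs : (#|F| < s)%N by lia.
rewrite ler_pdivlMr //.
pose Z : R := (nsup s F)%:R.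
(* On average over the [Z] sets that contain [F], the bracket of [weight_ge] is at least [b]. *)
have step1 : \prod_(A <- L) (p * #|A|%:R)^-1 * (Z * b) <=
    \sum_(S : {set T} | #|S| == s) weight F E L S.
  rewrite [leRHS](bigID (fun S : {set T} => F \subset S)) /= ler_wpDr //.
    by apply: sumr_ge0 => S _; apply: weight_ge0.
  rewrite [leRHS](eq_bigl (fun S => (F \subset S) && (#|S| == s))); last first.
    by move=> S; rewrite andbC.
  apply: le_trans; last first.
    by apply: ler_sum => S /andP[FS _]; apply: (weight_ge E p0 L0 FS).
  rewrite -mulr_sumr ler_wpM2l //.
    by apply: prodr_ge0 => A _; rewrite invr_ge0 mulr_ge0 // ltW.
  have sumZ (c : R) : \sum_(S : {set T} | (F \subset S) && (#|S| == s)) c = c * Z.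
    by rewrite big_const iter_addr_0 -mulr_natr /Z /nsup cardsE.
  have sumE (E' : {set T}) : [disjoint F & E'] ->
      \sum_(x in E') (nsup s (x |: F))%:R <= p * #|E'|%:R * Z.
    move=> FE'; apply: (@le_trans _ _ (\sum_(x in E') p * Z)).
      apply: ler_sum => x xE'; apply: nsupU1_le => //.
      by rewrite (disjointFl FE').
    by rewrite sumr_const -[leLHS]mulr_natr mulrAC lexx.
  rewrite !sumrB sumZ mul1r -mulr_sumr sum_card_setI_sup exchange_big /=.
  have hE := sumE _ FE.
  have hE' : (1 + (size L)%:R) * \sum_(x in E) (nsup s (x |: F))%:R
      <= (1 + q%:R) * (p * #|E|%:R) * Z.
    rewrite -[leRHS]mulrA ler_pM // ?addr_ge0 ?sumr_ge0 //.
    by rewrite lerD2l ler_nat.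
  suff hX : \sum_(A <- L) \sum_(S : {set T} | (F \subset S) && (#|S| == s))
     ((q.+1%:R + #|S :&: A|%:R) / (p * #|A|%:R) - 1)
     <= q%:R * ((q + q.+1)%:R / (p * Tl%:R)) * Z.
    by rewrite /b; lra.
  apply: (@le_trans _ _ (\sum_(A <- L) (q + q.+1)%:R / (p * Tl%:R) * Z)).
    rewrite big_seq [leRHS]big_seq; apply: ler_sum => A AL.
    have A0 : 0 < #|A|%:R :> R by rewrite ltr0n L0.
    rewrite sumrB sumZ mul1r -mulr_suml big_split /= sumZ sum_card_setI_sup.
    (* The at most [q] known elements of [A] lie in every [S]; with the offset [q.+1] they give the
       numerator [q + q.+1]. The fresh ones contribute at most [p * #|A|] on average, which the
       [- 1] cancels. *)
    have -> : \sum_(x in A) (nsup s (x |: F))%:R =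
        #|A :&: F|%:R * Z + \sum_(x in A :\: F) (nsup s (x |: F))%:R :> R.
      rewrite (big_setID F) /=; congr (_ + _).
      rewrite (eq_bigr (fun _ => Z)) ?sumr_const ?mulr_natl // => x.
      by rewrite inE => /andP[_ xF]; rewrite /Z (setUidPr _) ?sub1set.
    have DF : [disjoint F & A :\: F].
      by rewrite disjoint_sym disjoints_subset setDE subsetIr.
    have := sumE _ DF; set u := \sum_(x in _) _ => hu.
    have Z0 : 0 <= Z by [].
    have AF : #|A :&: F|%:R <= q%:R :> R.
      by rewrite ler_nat (leq_trans (subset_leq_card (subsetIr _ _))) // FL.
    have AD : #|A :\: F|%:R <= #|A|%:R :> R.
      by rewrite ler_nat subset_leq_card // subsetDl.
    apply: (@le_trans _ _ ((q + q.+1)%:R / (p * #|A|%:R) * Z)); last first.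
      have pA0 : 0 < p * #|A|%:R by rewrite pmulr_rgt0.
      have pTl0 : 0 < p * Tl%:R by rewrite pmulr_rgt0 // ltr0n.
      rewrite ler_wpM2r // ler_wpM2l // lef_pV2 ?posrE //.
      by rewrite ler_pM2l // ler_nat TlL.
    rewrite lerBlDr [X in _ <= X + _]mulrAC.
    have -> : (q + q.+1)%:R * Z / (p * #|A|%:R) + Z =
        ((q + q.+1)%:R * Z + p * #|A|%:R * Z) / (p * #|A|%:R).
      by field; rewrite !gt_eqF.
    apply: ler_wpM2r; first by rewrite invr_ge0 ltW // pmulr_rgt0.
    rewrite natrD.
    have : #|A :&: F|%:R * Z <= q%:R * Z by rewrite ler_wpM2r.
    have : p * #|A :\: F|%:R * Z <= p * #|A|%:R * Z.
      by rewrite ler_wpM2r // ler_wpM2l // ltW.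
    by lra.
  rewrite big_const_seq count_predT iter_addr_0 -[leLHS]mulr_natl -[leRHS]mulrA.
  rewrite ler_wpM2r ?ler_nat //.
  by rewrite mulr_ge0 ?divr_ge0 ?mulr_ge0 // ltW.
apply: le_trans step1.
have -> : \prod_(A <- L) (p * #|A|%:R)^-1 =
    p ^- size L * \prod_(A <- L) #|A|%:R^-1 :> R.
  under eq_bigr => A _ do rewrite invfM.
  by rewrite big_split /= big_const_seq count_predT iter_mulr_1 exprVn.
(* The factors [p^-1] make up for the share of sets that contain [F]; the remaining loss
   [(1 - q / s) ^+ #|F|] is linearised by Bernoulli's inequality. *)
have Zge : (1 - q%:R * (q%:R / s%:R)) * 'C(#|T|, s)%:R <= p ^- size L * Z.
  rewrite ler_pdivlMl ?exprn_gt0 //.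
  apply: le_trans (nsup_ge R (q := q) _ qs sT); last by rewrite FL.
  rewrite [leLHS]mulrA ler_wpM2r // FL.
  have -> : (s - q)%:R / #|T|%:R = p * (1 - q%:R / s%:R) :> R.
    by rewrite natrB ?(ltnW qs) // /p; field; rewrite !gt_eqF.
  rewrite [leRHS]exprMn ler_wpM2l ?exprn_ge0 ?(ltW p0) //.
  have x01 : 0 <= (q%:R / s%:R : R) <= 1.
    by rewrite divr_ge0 //= ler_pdivrMr // mul1r ler_nat ltnW.
  apply: le_trans (bernoulli_ineq _ x01).
  by rewrite lerD2l lerN2 ler_wpM2r ?ler_nat //; case/andP: x01.
have := ler_wpM2r (mulr_ge0 (prod_card_inv_ge0 L) b0) Zge.
by congr (_ <= _); ring.
Qed.

End Weight.

(** * The oracle in terms of solution sets, and strategies of bounded depth *)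

Lemma sum_option (R : realType) (T : finType) (f : option T -> R) :
  \sum_a f a = f None + \sum_x f (Some x).
Proof.
rewrite (bigD1 None) //= (reindex_omap Some id) /=; last by case.
by congr (_ + _); apply: eq_bigl => v; rewrite /= eqxx.
Qed.

Section Oracle.
Variables (R : realType) (n : nat).
Implicit Types (phi : formula n) (A S X : {set assignment n})
  (t : strategy R n) (B : set R).

(** The answer law depends on the queried formula only through its solution set, which is [S :&: A]
    for the input [psi S]. *)
Definition oracle X (a : option (assignment n)) : R :=
  match a with
  | None => (X == set0)%:R
  | Some v => (v \in X)%:R / #|X|%:R
  end.

Lemma sat_sampleE phi a : sat_sample R phi a = oracle (sol phi) a.
Proof. by case: a. Qed.

Lemma oracle_ge0 X a : 0 <= oracle X a.
Proof. by case: a => [v|] /=; rewrite ?divr_ge0. Qed.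

Lemma sol_FAnd_psi S A : sol (FAnd (psi S) (psi A)) = S :&: A.
Proof.
have E U v : sat v (psi U) = (v \in U) by rewrite -[in RHS](sol_psi U) inE.
by apply/setP => v; rewrite !inE /= !E.
Qed.

Lemma output_prob_ge0 phi B t : 0 <= output_prob phi B t.
Proof.
elim: t => [e|A k IH] /=; first by rewrite indicE.
by apply: sumr_ge0 => a _; rewrite mulr_ge0 // sat_sampleE oracle_ge0.
Qed.

Lemma output_probC phi B t :
  output_prob phi (~` B)%classic t = 1 - output_prob phi B t.
Proof.
elim: t => [e|A k IH] /=.
  by rewrite !indicE classical_sets.in_setC; case: (e \in B); rewrite ?subr0 ?subrr.
under eq_bigr => a _ do rewrite IH mulrBr mulr1.
by rewrite sumrB sat_sample_sum1.
Qed.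

Lemma output_prob_query S B A k :
  output_prob (psi S) B (Query A k) =
  \sum_a oracle (S :&: A) a * output_prob (psi S) B (k a).
Proof. by apply: eq_bigr => a _; rewrite sat_sampleE sol_FAnd_psi. Qed.

(** [num_queries] ignores answers of probability zero, so the tree may be deeper than the query
    bound there. Cutting it off makes the depth bound hold on every branch; under the query bound,
    the default output 0 is reached with probability zero only. *)
Fixpoint truncate (r : nat) (t : strategy R n) : strategy R n :=
  match t, r with
  | Output e, _ => Output n e
  | Query _ _, 0 => Output n 0
  | Query A k, r'.+1 => Query A (fun a => truncate r' (k a))
  end.

Fixpoint depth_le (r : nat) (t : strategy R n) : Prop :=
  match t, r with
  | Output _, _ => True
  | Query _ _, 0 => False
  | Query _ k, r'.+1 => forall a, depth_le r' (k a)
  end.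

Lemma depth_le_truncate r t : depth_le r (truncate r t).
Proof. by elim: t r => [e|A k IH] [|r] //= a; apply: IH. Qed.

Lemma output_prob_truncate r phi B t : (num_queries phi t <= r)%N ->
  output_prob phi B (truncate r t) = output_prob phi B t.
Proof.
elim: t r => [e|A k IH] [|r] //=; rewrite ltnS => kr.
apply: eq_bigr => a _.
have [a0|/negP a0] := boolP (0 < sat_sample R (FAnd phi (psi A)) a).
  by rewrite IH // (leq_trans _ kr) //; apply: (leq_bigmax_cond a).
have -> : sat_sample R (FAnd phi (psi A)) a = 0; last by rewrite !mul0r.
apply/eqP; rewrite eq_le leNgt sat_sampleE oracle_ge0 -sat_sampleE.
by rewrite andbT; apply/negP.
Qed.

End Oracle.

(** * The idealised run, which does not depend on the solution set *)

Section Ideal.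
Variables (R : realType) (n : nat).
Implicit Types (A F E : {set assignment n}) (t : strategy R n).

(* Probability that the idealised run from known solutions [F] and presumed
   nonsolutions [E] meets no fresh part of size strictly between [Ts] and [Tl]
   and draws no fresh element of [E]. *)
Fixpoint ideal (Ts Tl : nat) F E t : R :=
  match t with
  | Output _ => 1
  | Query A k =>
    if (Tl <= #|A :\: F|)%N then
      \sum_(x in A :\: F :\: E) ideal Ts Tl (x |: F) E (k (Some x))
        / #|A :\: F|%:R
    else if (#|A :\: F| <= Ts)%N then
      if A :&: F == set0 then ideal Ts Tl F (E :|: A :\: F) (k None)
      else \sum_(x in A :&: F) ideal Ts Tl F (E :|: A :\: F) (k (Some x))
             / #|A :&: F|%:R
    else 0
  end.

Lemma ideal_le1 Ts Tl F E t : ideal Ts Tl F E t <= 1.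
Proof.
have avg (V U : {set assignment n}) (f : assignment n -> R) : U \subset V ->
    (forall x, f x <= 1) -> \sum_(x in U) f x / #|V|%:R <= 1.
  move=> UV f1; rewrite -mulr_suml; have [->|V0] := eqVneq V set0.
    by rewrite cards0 invr0 mulr0.
  rewrite ler_pdivrMr ?ltr0n ?card_gt0 // mul1r.
  apply: (@le_trans _ _ (\sum_(x in U) 1)); first exact: ler_sum.
  by rewrite sumr_const ler_nat subset_leq_card.
elim: t F E => [e|A k IH] F E //=.
case: ifP => _; first by apply: avg => //; apply: subsetDl.
by do 2 case: ifP => _ //; apply: avg.
Qed.

End Ideal.

(** * Comparison of the idealised run with the true one *)

Section Transfer.
Variables (R : realType) (n q Ts Tl : nat).
Variables (D : {set assignment n} -> R) (B : {set assignment n} -> set R).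
Variable kappa : R.
Implicit Types (A F E S : {set assignment n}) (L : seq {set assignment n})
  (t : strategy R n).

Local Notation weight := (@weight R (assignment n) q).

(** At most [q] elements of [S :&: A] are known, so [#|S :&: A| <= q.+1 + #|S :&: (A :\: F)|]: the
    new factor of the weight is at most the true probability of the answer [x]. *)
Lemma weight_fresh A F E L S x : x \in A -> (#|F| <= q)%N ->
  weight (x |: F) E (A :\: F :: L) S
  <= weight F E L S * oracle R (S :&: A) (Some x).
Proof.
move=> xA Fq; rewrite /weight /= big_cons subUset sub1set inE xA andbT.
have [xS|_] := boolP (x \in S); last by rewrite /= !mul0r mulr_ge0 ?weight_ge0.
rewrite andTb mul1r [leLHS]mulrA [leLHS]mulrAC ler_wpM2l //.
  exact: (weight_ge0 R q F E L S).
have SA0 : (0 < #|S :&: A|)%N.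
  by rewrite card_gt0; apply/set0Pn; exists x; rewrite inE xS.
rewrite lef_pV2 ?posrE ?ltr0n ?ltr_wpDr // -natrD ler_nat.
rewrite -(cardsID F (S :&: A)) setIDA leq_add2r.
by rewrite (leq_trans (subset_leq_card (subsetIr _ _))) // ltnW.
Qed.

Lemma disjoint_setUD A F E S : F \subset S -> [disjoint E :|: A :\: F & S] ->
  [disjoint E & S] /\ S :&: A = A :&: F.
Proof.
move=> FS EAS; split.
  by apply: disjointWl EAS; apply: subsetUl.
apply/setP => x; rewrite !inE andbC; case xA: (x \in A) => //=.
apply/idP/idP => [xS|/(subsetP FS)//].
have := disjointFl EAS xS; rewrite !inE xA andbT => /negbT.
by rewrite negb_or negbK => /andP[].
Qed.

(** The left side is nonzero only if the fresh part misses [S]; then [S :&: A = A :&: F], and the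
    answer is uniform on a set that does not depend on [S]. *)
Lemma weight_known A F E L S x : x \in A :&: F ->
  weight F (E :|: A :\: F) L S / #|A :&: F|%:R
  <= weight F E L S * oracle R (S :&: A) (Some x).
Proof.
move=> xAF; have [FS|nFS] := boolP (F \subset S); last first.
  by rewrite {1}/weight (negbTE nFS) !mul0r mulr_ge0 ?weight_ge0 ?oracle_ge0.
have [EAS|nEAS] := boolP [disjoint E :|: A :\: F & S]; last first.
  by rewrite {1}/weight (negbTE nEAS) mulr0 !mul0r mulr_ge0 ?weight_ge0 ?oracle_ge0.
have [ES SA] := disjoint_setUD FS EAS.
by rewrite /weight EAS ES SA /= xAF div1r.
Qed.

Lemma weight_none A F E L S : A :&: F = set0 ->
  weight F (E :|: A :\: F) L S <= weight F E L S * oracle R (S :&: A) None.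
Proof.
move=> AF; have [FS|nFS] := boolP (F \subset S); last first.
  by rewrite {1}/weight (negbTE nFS) !mul0r mulr_ge0 ?weight_ge0 ?oracle_ge0.
have [EAS|nEAS] := boolP [disjoint E :|: A :\: F & S]; last first.
  by rewrite {1}/weight (negbTE nEAS) mulr0 !mul0r mulr_ge0 ?weight_ge0 ?oracle_ge0.
have [ES SA] := disjoint_setUD FS EAS.
by rewrite /weight EAS ES SA AF /= eqxx [leRHS]mulr1.
Qed.

Hypothesis D_ge0 : forall S, 0 <= D S.
Hypothesis leaf : forall F E L e, #|F| = size L -> (size L <= q)%N ->
  [disjoint F & E] -> (#|E| <= q * Ts)%N -> {in L, forall A, (Tl <= #|A|)%N} ->
  kappa * \prod_(A <- L) #|A|%:R^-1
  <= \sum_S D S * weight F E L S * \1_(B S) e.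

(** [B S] stands for the wrong outputs on [psi S], and [d] bounds the number of queries already
    made. By induction on the strategy, the weight after each answer is dominated by the weight
    before it times the probability of the answer; answers discarded by [ideal] only add nonnegative
    terms. At the end, [leaf] says that any fixed output is wrong with enough weight. *)
Lemma ideal_le_output r t : depth_le r t -> forall F E L d, (d + r <= q)%N ->
  #|F| = size L -> (size L <= d)%N ->
  [disjoint F & E] -> (#|E| <= d * Ts)%N -> {in L, forall A, (Tl <= #|A|)%N} ->
  kappa * \prod_(A <- L) #|A|%:R^-1 * ideal Ts Tl F E t
  <= \sum_S D S * weight F E L S * output_prob (psi S) (B S) t.
Proof.
elim: t r => [e|A k IH] r.
  move=> _ F E L d drq FL Ld FE Ed TlL /=; rewrite mulr1; apply: leaf => //.
    by lia.
  by apply: (leq_trans Ed); rewrite leq_mul2r; apply/orP; right; lia.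
case: r => [[]|r kr] F E L d drq FL Ld FE Ed TlL.
have Fq : (#|F| <= q)%N by rewrite FL; lia.
under [leRHS]eq_bigr => S _ do rewrite output_prob_query mulr_sumr.
rewrite exchange_big /=.
set P := kappa * _.
have term_ge0 S a : 0 <= D S * weight F E L S
    * (oracle R (S :&: A) a * output_prob (psi S) (B S) (k a)).
  apply: mulr_ge0; apply: mulr_ge0; rewrite ?D_ge0 ?weight_ge0 //.
    exact: oracle_ge0.
  exact: output_prob_ge0.
have sum_ge0 a : 0 <= \sum_S D S * weight F E L S
    * (oracle R (S :&: A) a * output_prob (psi S) (B S) (k a)).
  exact: sumr_ge0.
(* [c] is the part of the answer's probability that the weight does not store: 1 for a fresh answer
   or for bottom, [#|A :&: F|^-1] for a known one. *)
have step F' E' L' a c : 0 <= c ->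
    (forall S, weight F' E' L' S * c <= weight F E L S * oracle R (S :&: A) a) ->
    kappa * \prod_(A <- L') #|A|%:R^-1 * ideal Ts Tl F' E' (k a)
      <= \sum_S D S * weight F' E' L' S * output_prob (psi S) (B S) (k a) ->
    kappa * \prod_(A <- L') #|A|%:R^-1 * ideal Ts Tl F' E' (k a) * c
      <= \sum_S D S * weight F E L S
           * (oracle R (S :&: A) a * output_prob (psi S) (B S) (k a)).
  move=> c0 wle /(ler_wpM2r c0) /le_trans; apply.
  rewrite mulr_suml; apply: ler_sum => S _.
  rewrite mulrAC -[leLHS]mulrA -[leLHS]mulrA -[leRHS]mulrA ler_wpM2l //.
  by rewrite !mulrA ler_wpM2r ?output_prob_ge0.
have [TlA|_] := leqP Tl #|A :\: F|.
  rewrite sum_option; apply: ler_wpDl; first by apply: sumr_ge0.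
  rewrite mulr_sumr [leRHS](bigID (fun x => x \in A :\: F :\: E)) /=.
  apply: ler_wpDr; first by apply: sumr_ge0 => x _; apply: (sum_ge0 (Some x)).
  apply: ler_sum => x xAFE.
  have [xE xF xA] : [/\ x \notin E, x \notin F & x \in A].
    by move: xAFE; rewrite !inE => /and3P[].
  (* The factor [#|A :\: F|^-1] of the uniform draw becomes that of the new entry of the list. *)
  rewrite [leLHS](_ : _ = kappa * \prod_(C <- A :\: F :: L) #|C|%:R^-1
      * ideal Ts Tl (x |: F) E (k (Some x)) * 1); last first.
    by rewrite big_cons /P; ring.
  apply: step => //.
  - by move=> S; rewrite mulr1; apply: weight_fresh.
  apply: (IH _ r (kr _) _ _ _ d.+1) => //.
  - by lia.
  - by rewrite cardsU1 xF FL.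
  - by rewrite -setI_eq0 setIUl setU_eq0 !setI_eq0 FE disjoints1 xE.
  - by rewrite mulSn; lia.
  - by move=> C; rewrite inE => /predU1P[->//|/TlL].
have [ATs|_] := leqP #|A :\: F| Ts; last first.
  by rewrite mulr0; apply: sumr_ge0 => a _; apply: sumr_ge0.
have E'd : (#|E :|: A :\: F| <= d.+1 * Ts)%N.
  by rewrite (leq_trans (leq_card_setU _ _)) // mulSn addnC leq_add.
have FE' : [disjoint F & E :|: A :\: F].
  rewrite -setI_eq0 setIUr setU_eq0 !setI_eq0 FE.
  by rewrite disjoint_sym disjoints_subset setDE subsetIr.
have [AF0|AF0] := eqVneq (A :&: F) set0.
  rewrite sum_option.
  apply: ler_wpDr; first by apply: sumr_ge0 => x _; apply: (sum_ge0 (Some x)).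
  rewrite -[leLHS]mulr1; apply: step => //.
    by move=> S; rewrite mulr1; apply: weight_none.
  by apply: (IH _ r (kr _) _ _ _ d.+1) => //; lia.
rewrite sum_option; apply: ler_wpDl; first by apply: sumr_ge0.
rewrite mulr_sumr [leRHS](bigID (fun x => x \in A :&: F)) /=.
apply: ler_wpDr; first by apply: sumr_ge0 => x _; apply: (sum_ge0 (Some x)).
apply: ler_sum => x xAF; rewrite mulrA; apply: step.
- by rewrite invr_ge0.
- by move=> S; apply: weight_known.
by apply: (IH _ r (kr _) _ _ _ d.+1) => //; lia.
Qed.

End Transfer.

(** * Failures of the idealised run, summed over the cells *)

Section SumIdeal.
Variables (R : realType) (n q K : nat) (Ts Tl : 'I_K -> nat) (eta : R).
Implicit Types (A F : {set assignment n}) (E : 'I_K -> {set assignment n})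
  (t : strategy R n).

Hypothesis windows_disjoint : forall a i j,
  (Ts i < a < Tl i)%N -> (Ts j < a < Tl j)%N -> i = j.
Hypothesis Tl_gt0 : forall i, (0 < Tl i)%N.
Hypothesis Ts_Tl : forall i, (q * Ts i)%:R <= eta * (Tl i)%:R.
Hypothesis eta_ge0 : 0 <= eta.

(** A uniform draw from [A] falls in [E] with probability at most [eta]; any other draw [x] loses
    only [1 - g x]. *)
Lemma ideal_fail_fresh A (E : {set assignment n})
    (g : assignment n -> R) :
  (0 < #|A|)%N -> #|E|%:R <= eta * #|A|%:R -> (forall x, g x <= 1) ->
  1 - \sum_(x in A :\: E) g x / #|A|%:R
    <= eta + \sum_(x in A) (1 - g x) / #|A|%:R.
Proof.
move=> A0 EA g1; have A0' : 0 < #|A|%:R :> R by rewrite ltr0n.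
rewrite -(ler_pM2r A0') mulrBl mulrDl -!mulr_suml !divfK ?gt_eqF // mul1r.
have : \sum_(x in A :\: E) (1 - g x) <= \sum_(x in A) (1 - g x).
  rewrite [leRHS](big_setID E) /= lerDr sumr_ge0 // => x _.
  by rewrite subr_ge0.
rewrite sumrB sumr_const.
have : #|A|%:R <= #|E|%:R + #|A :\: E|%:R :> R.
  by rewrite -natrD ler_nat -(cardsID E A) leq_add2r subset_leq_card // subsetIr.
by lra.
Qed.

(* The bound [f r] satisfies [f r.+1 = 2 * f r + 1 + K * eta]: at a query the
   cells split into large and small ones, and at most one is in its window. *)
Lemma sum_ideal_fail r t : depth_le r t ->
  forall F d E (I : pred 'I_K), (d + r <= q)%N ->
  (forall i, I i -> (#|E i| <= d * Ts i)%N) ->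
  \sum_(i | I i) (1 - ideal (Ts i) (Tl i) F (E i) t)
    <= (2 ^+ r - 1) * (1 + K%:R * eta).
Proof.
have pos c m : 0 <= c -> 0 <= (2 ^+ m - 1) * (1 + K%:R * c) :> R.
  move=> c0; apply: mulr_ge0; first by rewrite subr_ge0 exprn_ege1 // ler1n.
  by rewrite addr_ge0 ?mulr_ge0.
elim: t r => [e|A k IH] r.
  by move=> _ F d E I _ _; rewrite big1 ?pos //= => i _; rewrite subrr.
case: r => [[]|r kr] F d E I drq Ed.
have {}IH a F' d' E' I' := IH a r (kr a) F' d' E' I'.
set c := 1 + K%:R * eta in IH *.
have -> : (2 ^+ r.+1 - 1) * c = ((2 ^+ r - 1) * c + K%:R * eta)
    + ((2 ^+ r - 1) * c + 1) by rewrite exprS /c; ring.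
(* All cells of a group see the same law of answers, so their failures can be summed for each answer
   [x] separately and then averaged. *)
have avg (V : {set assignment n}) (J : pred 'I_K) (g : 'I_K -> assignment n -> R) :
    (forall x, \sum_(i | J i) (1 - g i x) <= (2 ^+ r - 1) * c) ->
    \sum_(i | J i) \sum_(x in V) (1 - g i x) / #|V|%:R <= (2 ^+ r - 1) * c.
  move=> gJ; rewrite exchange_big /=.
  apply: (@le_trans _ _ (\sum_(x in V) (2 ^+ r - 1) * c / #|V|%:R)).
    by apply: ler_sum => x _; rewrite -mulr_suml ler_wpM2r.
  rewrite sumr_const -[leLHS]mulr_natr; have [->|V0] := eqVneq V set0.
    by rewrite cards0 mulr0 pos.
  by rewrite divfK // pnatr_eq0 cards_eq0.
rewrite (bigID (fun i => (Tl i <= #|A :\: F|)%N)) /=; apply: lerD.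
  apply: (@le_trans _ _ (\sum_(i | I i && (Tl i <= #|A :\: F|)%N) (eta +
      \sum_(x in A :\: F) (1 - ideal (Ts i) (Tl i) (x |: F) (E i) (k (Some x)))
        / #|A :\: F|%:R))).
    apply: ler_sum => i /andP[Ii TlA]; rewrite TlA.
    apply: ideal_fail_fresh => [||x]; last exact: ideal_le1.
      exact: leq_trans (Tl_gt0 i) TlA.
    apply: (@le_trans _ _ (q * Ts i)%:R).
      rewrite ler_nat (leq_trans (Ed i Ii)) // leq_mul2r; apply/orP; right; lia.
    by rewrite (le_trans (Ts_Tl i)) // ler_wpM2l // ler_nat.
  rewrite big_split /= addrC lerD //; last first.
    rewrite sumr_const -[leLHS]mulr_natl ler_wpM2r // ler_nat.
    by rewrite -[leqRHS](card_ord K) max_card.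
  apply: avg => x; apply: (IH _ _ d); first by lia.
  by move=> i /andP[/Ed].
rewrite (bigID (fun i => (#|A :\: F| <= Ts i)%N)) /=; apply: lerD.
  have E'd i : I i && ~~ (Tl i <= #|A :\: F|)%N && (#|A :\: F| <= Ts i)%N ->
      (#|E i :|: A :\: F| <= d.+1 * Ts i)%N.
    move=> /andP[/andP[/Ed Ei _] ATs].
    by rewrite (leq_trans (leq_card_setU _ _)) // mulSn addnC leq_add.
  have drq' : (d.+1 + r <= q)%N by lia.
  have [AF0|AF0] := eqVneq (A :&: F) set0.
    apply: le_trans (IH None F d.+1 (fun i => E i :|: A :\: F) _ drq' E'd).
    apply: ler_sum => i /andP[/andP[_ /negbTE ->] ->].
    by [].
  apply: le_trans (avg (A :&: F) _ (fun i x => ideal (Ts i) (Tl i) F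
    (E i :|: A :\: F) (k (Some x))) _).
    apply: ler_sum => i /andP[/andP[_ /negbTE ->] ->].
    rewrite -!mulr_suml sumrB sumr_const mulrBl divff //.
    by rewrite pnatr_eq0 cards_eq0.
  by move=> x; apply: IH drq' E'd.
apply: (@le_trans _ _ (\sum_(i | (I i && ~~ (Tl i <= #|A :\: F|)%N)
    && ~~ (#|A :\: F| <= Ts i)%N) 1)).
  by apply: ler_sum => i /andP[/andP[_ /negbTE ->] /negbTE ->]; rewrite subr0.
rewrite sumr_const lern1; apply/card_le1_eqP => i j.
rewrite !unfold_in -!ltnNge => /andP[/andP[_ i1] i2] /andP[/andP[_ j1] j2].
by apply: (windows_disjoint (a := #|A :\: F|)); rewrite ?i1 ?i2 ?j1 ?j2.
Qed.

End SumIdeal.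

(** * Averaging over the internal randomness, as in the easy half of Yao's principle *)

Lemma average_le d (T : measurableType d) (R : realType) (P : probability T R)
    (I : finType) (f : I -> T -> R) (c : I -> R) (a b : R) :
  (forall i, measurable_fun [set: T]%classic (f i)) ->
  (forall i w, 0 <= f i w) -> (forall i, 0 <= c i) ->
  (forall i, (a%:E <= \int[P]_w (f i w)%:E)%E) ->
  (forall w, \sum_i c i * f i w <= b) -> (\sum_i c i) * a <= b.
Proof.
move=> mf f0 c0 af fb; rewrite -lee_fin mulr_suml -sumEFin.
have mcf i : measurable_fun [set: T]%classic
    (fun w => ((c i)%:E * (f i w)%:E)%E : \bar R).
  by apply/measurable_EFinP; apply: measurable_funM.
apply: (@le_trans _ _ (\sum_i \int[P]_w ((c i)%:E * (f i w)%:E))%E).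
  apply: lee_sum => i _; rewrite ge0_integralZl_EFin //.
  - by rewrite EFinM lee_wpmul2l ?lee_fin.
  - by move=> w _; rewrite lee_fin.
  - exact/measurable_EFinP.
rewrite -ge0_integral_sum //; last first.
  by move=> i w _; rewrite -EFinM lee_fin mulr_ge0.
apply: (@le_trans _ _ (\int[P]_w b%:E)%E); last first.
  by rewrite integral_cst // [X in (_ * X)%E]probability_setT mule1.
apply: ge0_le_integral => //.
- by move=> w _; apply: sume_ge0 => i _; rewrite -EFinM lee_fin mulr_ge0.
- exact: emeasurable_sum.
- by move=> w _; under eq_bigr do rewrite -EFinM; rewrite sumEFin lee_fin.
Qed.

(** * Numerical estimates for one cell *)

Lemma card_assignment n : #|{: assignment n}| = (2 ^ n)%N.
Proof. by rewrite card_ffun card_bool card_ord. Qed.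

Section Cell.
Variables (R : realType) (n q e u : nat).
Hypothesis u_ge2 : (2 <= u)%N.
Hypothesis u_large : (6 * (7 * q ^ 2 + 5 * q) <= 2 ^ u)%N.
Hypothesis ue : (u <= e)%N.
Hypothesis un : (e + u <= n)%N.

(** With [x = 2 ^- u], the error terms of [sum_weight_ge] are at most [q ^ 2 * x],
    [(4 * q ^ 2 + 4 * q) * x] and [(2 * q ^ 2 + q) * x]; by [u_large] they total at most 1/6. *)
Lemma cell_weight_ge f (F E : {set assignment n}) (L : seq {set assignment n}) :
  (e <= f <= e + 2)%N -> #|F| = size L -> (size L <= q)%N -> [disjoint F & E] ->
  (#|E| <= q * 2 ^ (n - e - u))%N ->
  {in L, forall A : {set assignment n}, (2 ^ (n - e + u) <= #|A|)%N} ->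
  5 / 6 * \prod_(A <- L) #|A|%:R^-1
  <= (\sum_(S : {set assignment n} | #|S| == (2 ^ f)%N) weight R q F E L S)
     / 'C(2 ^ n, 2 ^ f)%:R.
Proof.
move=> /andP[ef fe] FL Lq FE Eq TlL.
have qf : (q < 2 ^ f)%N.
  have : (2 ^ u <= 2 ^ f)%N by rewrite leq_exp2l // (leq_trans ue).
  by move: u_large (expn_gt0 2 f); nia.
have fn : (2 ^ f <= #|{: assignment n}|)%N.
  by rewrite card_assignment leq_exp2l //; lia.
have X0 m : 0 < 2 ^+ m :> R by rewrite exprn_gt0.
set x : R := (2 ^+ u)^-1; have x0 : 0 < x by rewrite invr_gt0.
have err : (7 * q%:R ^+ 2 + 5 * q%:R) * x <= 6^-1.
  rewrite ler_pdivrMr // ler_pdivlMl //.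
  by move: u_large; rewrite -(ler_nat R) natrM natrD !natrM !natrX.
set p : R := (2 ^ f)%:R / #|{: assignment n}|%:R.
have pE : p = 2 ^+ f / 2 ^+ n by rewrite /p card_assignment !natrX.
have p0 : 0 < p by rewrite pE divr_gt0.
(* The factor 4 comes from the worst case [f = e + 2]. *)
have h1 : p * #|E|%:R <= 4 * q%:R * x.
  apply: (@le_trans _ _ (2 ^+ (e + 2) / 2 ^+ n * (q%:R * 2 ^+ (n - e - u)))).
    apply: ler_pM => //; first exact: ltW.
      rewrite pE; apply: ler_wpM2r; first by rewrite invr_ge0 ltW.
      by rewrite ler_weXn2l // ler1n.
    by rewrite -natrX -natrM ler_nat.
  have -> : 2 ^+ n = 2 ^+ e * 2 ^+ u * 2 ^+ (n - e - u) :> R.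
    by rewrite -!exprD; congr (_ ^+ _); lia.
  have -> : 2 ^+ (e + 2) = 4 * 2 ^+ e :> R by rewrite exprD; ring.
  rewrite le_eqVlt; apply/orP; left; apply/eqP; rewrite /x.
  have := (X0 e, X0 u, X0 (n - e - u)%N).
  move: (2 ^+ e) (2 ^+ u) (2 ^+ (n - e - u)) => y1 y2 y3 [[y10 y20] y30].
  by field; rewrite !gt_eqF.
have h2 : (p * (2 ^ (n - e + u))%:R)^-1 <= x.
  rewrite /x lef_pV2 ?posrE ?X0 //; last by rewrite pmulr_rgt0 // natrX.
  rewrite pE natrX mulrAC ler_pdivlMr // -!exprD ler_weXn2l // ?ler1n //.
  by lia.
have h3 : (2 ^ f)%:R^-1 <= x.
  by rewrite /x natrX lef_pV2 ?posrE // ler_weXn2l // ?ler1n //; lia.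
have q0 : 0 <= q%:R :> R by [].
have a1 : q%:R * (q%:R / (2 ^ f)%:R) <= q%:R ^+ 2 * x.
  by rewrite mulrA -expr2 ler_wpM2l // exprn_ge0.
have b1 : (1 + q%:R) * (p * #|E|%:R) <= (4 * q%:R ^+ 2 + 4 * q%:R) * x.
  apply: le_trans (ler_wpM2l _ h1) _; first by rewrite addr_ge0.
  by rewrite le_eqVlt; apply/orP; left; apply/eqP; ring.
have b2 : q%:R * ((q + q.+1)%:R / (p * (2 ^ (n - e + u))%:R))
    <= (2 * q%:R ^+ 2 + q%:R) * x.
  rewrite mulrA; apply: le_trans (ler_wpM2l _ h2) _; first by rewrite mulr_ge0.
  by rewrite natrD -natr1 le_eqVlt; apply/orP; left; apply/eqP; ring.
have xq2 : 0 <= q%:R ^+ 2 * x by rewrite mulr_ge0 ?exprn_ge0 // ltW.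
have xq : 0 <= q%:R * x by rewrite mulr_ge0 // ltW.
have b0 : 0 <= 1 - (1 + q%:R) * (p * #|E|%:R)
    - q%:R * ((q + q.+1)%:R / (p * (2 ^ (n - e + u))%:R)) by lra.
have Tl0 : (0 < 2 ^ (n - e + u))%N by rewrite expn_gt0.
rewrite -(card_assignment n).
apply: le_trans (sum_weight_ge FL Lq qf fn FE Tl0 TlL b0).
rewrite ler_wpM2r ?prod_card_inv_ge0 //.
rewrite -/p.
move: b0 a1 b1 b2; set al := q%:R * (q%:R / _); set b := 1 - _ - _.
move=> b0 a1 b1 b2.
have bge : 1 - (6 * q%:R ^+ 2 + 5 * q%:R) * x <= b by rewrite /b; lra.
have al0 : 0 <= al by rewrite /al mulr_ge0 ?divr_ge0.
have b1' : b <= 1.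
  have : 0 <= (1 + q%:R) * (p * #|E|%:R) by rewrite !mulr_ge0 ?addr_ge0 // ltW.
  have : 0 <= q%:R * ((q + q.+1)%:R / (p * (2 ^ (n - e + u))%:R)).
    by rewrite !mulr_ge0 ?invr_ge0 ?mulr_ge0 // ltW.
  by rewrite /b; lra.
have : al * b <= al by rewrite ler_piMr.
by lra.
Qed.

End Cell.

(** * The law of the hard inputs, and the approximation windows *)

Section Law.
Variables (R : realType) (n e : nat).
Implicit Types S : {set assignment n}.

(* The sum of two probability laws, so its total mass is 2. *)
Definition law S : R :=
  (#|S| == 2 ^ e)%N%:R / 'C(2 ^ n, 2 ^ e)%:R
  + (#|S| == 2 ^ (e + 2))%N%:R / 'C(2 ^ n, 2 ^ (e + 2))%:R.

Lemma law_ge0 S : 0 <= law S.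
Proof. by rewrite addr_ge0 ?divr_ge0. Qed.

Lemma sum_law_size f (g : {set assignment n} -> R) :
  \sum_(S : {set assignment n}) (#|S| == 2 ^ f)%N%:R / 'C(2 ^ n, 2 ^ f)%:R * g S
  = (\sum_(S : {set assignment n} | #|S| == (2 ^ f)%N) g S)
    / 'C(2 ^ n, 2 ^ f)%:R.
Proof.
rewrite mulr_suml [RHS]big_mkcond; apply: eq_bigr => S _.
by case: ifP => _; rewrite ?mul0r // mul1r mulrC.
Qed.

Lemma sum_law : (e + 2 <= n)%N -> \sum_(S : {set assignment n}) law S = 2.
Proof.
move=> en; have half f : (f <= n)%N ->
    \sum_(S : {set assignment n}) (#|S| == 2 ^ f)%N%:R / 'C(2 ^ n, 2 ^ f)%:R = 1 :> R.
  move=> fn; have := sum_law_size f (fun=> 1).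
  under eq_bigr do rewrite mulr1; move=> ->.
  have -> : \sum_(S : {set assignment n} | #|S| == (2 ^ f)%N) 1 =
      'C(2 ^ n, 2 ^ f)%:R :> R.
    rewrite -(card_assignment n) -card_draws -sum1_card natr_sum.
    by apply: eq_bigl => S; rewrite inE.
  by rewrite divff // pnatr_eq0 -lt0n bin_gt0 leq_exp2l.
by rewrite big_split /= (half _ en) half // (leq_trans _ en) // leq_addr.
Qed.

End Law.

Section Window.
Variables (R : realType) (eps : R).

Definition window (m : nat) : set R :=
  [set x : R | (m%:R / (1 + eps) <= x <= (1 + eps) * m%:R)%R]%classic.

Lemma measurable_window m : measurable (window m).
Proof. by rewrite /window -set_itvcc; apply: measurable_itv. Qed.

(** The windows are disjoint as soon as [(1 + eps) ^ 2 < 4]; for [eps < 1 / 2] the square is below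
    9/4. *)
Lemma windows_far m (x : R) : 0 <= eps -> eps < 1 / 2 ->
  (0 < m)%N -> window m x -> ~ window (4 * m) x.
Proof.
move=> eps_ge0 eps_lt m0; rewrite /window /= => /andP[_ xm] /andP[mx _].
have m0' : 0 < m%:R :> R by rewrite ltr0n.
have e1 : 0 < 1 + eps by rewrite ltr_wpDr.
move: mx; rewrite ler_pdivrMr // natrM => mx.
have : x * (1 + eps) <= (1 + eps) * m%:R * (1 + eps) by rewrite ler_wpM2r // ltW.
have : (1 + eps) * (1 + eps) * m%:R < 4 * m%:R.
  rewrite ltr_pM2r //.
  have : eps * eps <= eps * (1 / 2) by rewrite ler_wpM2l // ltW.
  by lra.
by lra.
Qed.

End Window.

(** * Success probability on one cell *)

Section CellPair.
Variables (R : realType) (n q e u : nat) (eps : R).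
Implicit Types S : {set assignment n}.
Hypothesis u_ge2 : (2 <= u)%N.
Hypothesis u_large : (6 * (7 * q ^ 2 + 5 * q) <= 2 ^ u)%N.
Hypothesis ue : (u <= e)%N.
Hypothesis un : (e + u <= n)%N.
Hypothesis eps_ge0 : 0 <= eps.
Hypothesis eps_lt : eps < 1 / 2.

Local Notation law := (law R e).
Local Notation window := (window eps).

(** No output lies in the windows of both sizes, so [x] is wrong for one of them, and that half of
    [law] alone gives the bound. *)
Lemma cell_leaf (F E : {set assignment n}) (L : seq {set assignment n}) (x : R) :
  #|F| = size L -> (size L <= q)%N -> [disjoint F & E] ->
  (#|E| <= q * 2 ^ (n - e - u))%N ->
  {in L, forall A : {set assignment n}, (2 ^ (n - e + u) <= #|A|)%N} ->
  5 / 6 * \prod_(A <- L) #|A|%:R^-1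
  <= \sum_(S : {set assignment n}) law S * weight R q F E L S
       * \1_(~` window #|S|)%classic x.
Proof.
move=> FL Lq FE Eq TlL.
have key f : (e <= f <= e + 2)%N -> ~ window (2 ^ f) x ->
    (forall S, (#|S| == 2 ^ f)%N%:R / 'C(2 ^ n, 2 ^ f)%:R <= law S) ->
    5 / 6 * \prod_(A <- L) #|A|%:R^-1
    <= \sum_(S : {set assignment n}) law S * weight R q F E L S
       * \1_(~` window #|S|)%classic x.
  move=> ef xf lawf.
  apply: le_trans (cell_weight_ge R u_ge2 u_large ue un ef FL Lq FE Eq TlL) _.
  rewrite -sum_law_size; apply: ler_sum => S _.
  have w0 : 0 <= weight R q F E L S by apply: weight_ge0.
  have [Sf|_] := eqVneq #|S| (2 ^ f)%N; last first.
    rewrite !mul0r; apply: mulr_ge0; last by rewrite indicE.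
    by apply: mulr_ge0 => //; apply: law_ge0.
  have := lawf S; rewrite Sf eqxx indicE => lawS.
  by rewrite mem_set // mulr1 ler_wpM2r.
have [xe|xe] := pselect (window (2 ^ e) x).
  apply: (key (e + 2)%N); first by lia.
    by rewrite expnD mulnC; apply: windows_far; rewrite ?expn_gt0.
  by move=> S; rewrite /law lerDr divr_ge0.
apply: (key e) => //; first by lia.
by move=> S; rewrite /law lerDl divr_ge0.
Qed.

(** The comparison from the empty history, whose weight is 1, bounds the failure from below; it is
    subtracted from the total mass 2. *)
Lemma cell_success r (t : strategy R n) : (r <= q)%N -> depth_le r t ->
  \sum_(S : {set assignment n}) law S * output_prob (psi S) (window #|S|) t
  <= 2 - 5 / 6 * ideal (2 ^ (n - e - u)) (2 ^ (n - e + u)) set0 set0 t.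
Proof.
move=> rq tr.
have := @ideal_le_output R n q _ _ law (fun S => ~` window #|S|)%classic (5 / 6)
  (law_ge0 R e) cell_leaf r t tr set0 set0 [::] 0 rq (cards0 _) isT.
rewrite big_nil mulr1 cards0 -setI_eq0 setI0 eqxx => /(_ isT isT) H.
have {}H := H (fun A (AL : A \in [::]) => ltac:(by [])).
have -> : \sum_(S : {set assignment n}) law S * output_prob (psi S) (window #|S|) t =
    2 - \sum_(S : {set assignment n}) law S * weight R q set0 set0 [::] S
        * output_prob (psi S) (~` window #|S|)%classic t.
  have en : (e + 2 <= n)%N by apply: leq_trans un; rewrite leq_add2l.
  rewrite -(sum_law R en) -sumrB; apply: eq_bigr => S _.
  rewrite output_probC /weight sub0set big_nil -setI_eq0 set0I eqxx !mulr1.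
  by ring.
by lra.
Qed.

End CellPair.

(** * Choice of the parameters and conclusion *)

Lemma approx_queries (R : realType) (eps delta : R) (n : nat)
    (M : algorithm R n) (q : nat) :
  0 <= eps -> eps < 1 / 2 -> delta <= 1 / 6 ->
  (forall phi : formula n, approximates M eps delta phi) -> query_bound M q ->
  (n < (2 * q + 8) * (2 * 2 ^ (q + 3) + 1))%N.
Proof.
move=> e0 e12 d6 Mapx Mq; rewrite ltnNge; apply/negP => nbig.
(* [K] makes [2 ^ q] equal to [K / 8], and [u] is large enough for [u_large]. The assumed bound on
   [n] leaves room for [K] cells spaced [2 * u] apart. *)
set u := (2 * q + 8)%N in nbig; set K := (2 ^ (q + 3))%N in nbig.
have K0 : 0 < K%:R :> R by rewrite ltr0n expn_gt0.
pose e (i : 'I_K) := (2 * u * i.+1)%N.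
have u_ge2 : (2 <= u)%N by rewrite /u; lia.
have u_large : (6 * (7 * q ^ 2 + 5 * q) <= 2 ^ u)%N.
  rewrite /u expnD (mulnC 2) expnM -[(2 ^ 8)%N]/256%N.
  by have := ltn_expl q (isT : 1 < 2)%N; nia.
have ue i : (u <= e i)%N by rewrite /e; nia.
have un i : (e i + u <= n)%N.
  by apply: leq_trans nbig; rewrite /e; have := ltn_ord i; nia.
have en i : (e i + 2 <= n)%N by apply: leq_trans (un i); rewrite leq_add2l.
pose Ts i := (2 ^ (n - e i - u))%N; pose Tl i := (2 ^ (n - e i + u))%N.
pose eta : R := q%:R / 2 ^+ (2 * u).
have eta0 : 0 <= eta by rewrite divr_ge0 // exprn_ge0.
have wdisj a i j : (Ts i < a < Tl i)%N -> (Ts j < a < Tl j)%N -> i = j.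
  (* For [i1 < i2] the spacing gives [Tl i2 <= Ts i1], so the open windows cannot meet. *)
  have lt (i1 i2 : 'I_K) : (i1 < i2)%N -> (Ts i1 < a)%N -> (a < Tl i2)%N -> False.
    move=> i12 h1 h2; have := ltn_trans h1 h2.
    rewrite /Ts /Tl ltn_exp2l // /e; have := un i2; rewrite /e; nia.
  move=> /andP[i1 i2] /andP[j1 j2]; apply: val_inj => /=.
  have [ij|ji|//] := ltngtP i j; first by case: (lt i j).
  by case: (lt j i).
have TsTl i : (q * Ts i)%:R <= eta * (Tl i)%:R.
  rewrite /eta /Ts /Tl natrM !natrX mulrAC -mulrA ler_wpM2l //.
  rewrite ler_pdivlMr ?exprn_gt0 // -exprD ler_weXn2l ?ler1n //.
  by have := un i; lia.
have Kerr : K%:R * (2 ^+ q * eta) <= K%:R / 8.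
  rewrite ler_wpM2l // /eta mulrA ler_pdivrMr ?exprn_gt0 // ler_pdivlMl //.
  have -> : 2 ^+ (2 * u) = 2 ^+ q * 2 ^+ q * 2 ^+ (2 * q + 16) :> R.
    by rewrite -!exprD; congr (_ ^+ _); rewrite /u; lia.
  have q2 : q%:R <= 2 ^+ q :> R by rewrite -natrX ler_nat ltnW // ltn_expl.
  have : (8 : R) <= 2 ^+ (2 * q + 16).
    have -> : 8 = 2 ^+ 3 :> R by ring.
    by rewrite ler_weXn2l ?ler1n //; lia.
  have p0 : 0 < 2 ^+ q :> R by rewrite exprn_gt0.
  move: (2 ^+ q) (2 ^+ (2 * q + 16)) p0 q2 => x y x0 qx y8.
  have : x * q%:R <= x * x by rewrite ler_wpM2l // ltW.
  have : 8 * (x * x) <= y * (x * x) by rewrite ler_wpM2r // mulr_ge0 // ltW.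
  by nra.
have KE : K%:R = 8 * 2 ^+ q :> R by rewrite /K natrX exprD; ring.
(* The failures total at most [2 ^ q * (1 + K * eta) <= K / 8 + K / 8], so the sum is at most
   [2 * K - 5 / 6 * (K - K / 4) = 11 / 8 * K]. *)
have point (w : seed M) : \sum_(S : {set assignment n}) (\sum_i law R (e i) S)
    * output_prob (psi S) (window eps #|S|) (run w) <= 11 / 8 * K%:R.
  set t := truncate q (run w).
  have tq : depth_le q t by apply: depth_le_truncate.
  under eq_bigr => S _ do
    rewrite -(output_prob_truncate (r := q)) ?Mq // mulr_suml.
  rewrite exchange_big /=.
  apply: (@le_trans _ _ (\sum_(i < K) (2 - 5 / 6 * ideal (Ts i) (Tl i) set0 set0 t))).
    by apply: ler_sum => i _;
      apply: (cell_success u_ge2 u_large (ue i) (un i) e0 e12 (leqnn q) tq).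
  have := @sum_ideal_fail R n q K Ts Tl eta wdisj _ TsTl eta0 q t tq set0 0
    (fun=> set0) xpredT (leqnn q).
  have Tl0 i : (0 < Tl i)%N by rewrite expn_gt0.
  move=> /(_ Tl0) H; have {}H := H (fun i _ => ltac:(by rewrite cards0)).
  move: H; rewrite !sumrB -mulr_sumr !sumr_const card_ord -[2 *+ K]mulr_natr => H.
  have : 0 <= K%:R * eta by rewrite mulr_ge0.
  by lra.
have := @average_le _ _ R (seed_law M) {set assignment n}
  (fun S w => output_prob (psi S) (window eps #|S|) (run w))
  (fun S => \sum_i law R (e i) S) (5 / 6) (11 / 8 * K%:R).
have -> : \sum_(S : {set assignment n}) \sum_i law R (e i) S = 2 * K%:R :> R.
  rewrite exchange_big /=; under eq_bigr => i _ do rewrite (sum_law R (en i)).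
  by rewrite sumr_const card_ord mulr_natr.
move=> H.
(* Success with probability at least 5/6 on every input would give [5 / 3 * K], which exceeds
   [11 / 8 * K]. *)
have : 2 * K%:R * (5 / 6) <= 11 / 8 * K%:R :> R; last by lra.
apply: H => //.
- by move=> S; apply: measurable_run; apply: measurable_window.
- by move=> S w; apply: output_prob_ge0.
- by move=> S; apply: sumr_ge0 => i _; apply: law_ge0.
move=> S; have := Mapx (psi S); rewrite /approximates /estimate_prob sol_psi.
by apply: le_trans; rewrite lee_fin; lra.
Qed.

Theorem theorem2 (R : realType) :
  exists (c : R) (N : nat), 0 < c /\
    forall (eps delta : R), 0 <= eps -> eps < 1 / 2 -> delta <= 1 / 6 ->
    forall (n : nat), (N <= n)%N ->
    forall (M : algorithm R n) (q : nat),
      (forall phi : formula n, approximates M eps delta phi) ->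
      query_bound M q ->
      c * (ln n%:R / ln (ln n%:R)) <= q%:R.
Proof.
(* The threshold ensures [ln n >= 16], so [ln n <= 2 * q + 8 <= 2 * q + ln n / 2] and
   [ln n / 4 <= q]. The term [expR 1] ensures [ln (ln n) >= 1], so dividing by it preserves the
   bound. *)
exists (1 / 4), (Num.truncn (expR (expR 1 + 16) : R)).+1; split; first by lra.
move=> eps delta e0 e12 d6 n Nn M q Mapx Mq.
have nlt : (n <= 2 ^ (2 * q + 8))%N.
  apply: leq_trans (ltnW (approx_queries e0 e12 d6 Mapx Mq)) _.
  have q2 : (q + 4 <= 2 ^ (q + 2))%N by elim: (q) => // m; rewrite !addSn expnS; lia.
  apply: (@leq_trans (2 ^ (q + 3) * 2 ^ (q + 5))); last first.
    by rewrite -expnD leq_exp2l //; lia.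
  by apply: leq_mul; rewrite !expnD in q2 *; lia.
have nbig : expR (expR 1 + 16) <= n%:R :> R.
  by apply: le_trans (ltW (truncnS_gt _)) _; rewrite ler_nat.
have n0 : 0 < n%:R :> R by apply: lt_le_trans nbig; apply: expR_gt0.
have lnbig : expR 1 + 16 <= ln n%:R :> R.
  by rewrite -[leLHS]expRK ler_ln ?posrE ?expR_gt0.
have e1 : 0 < expR 1 :> R by apply: expR_gt0.
have lnln : 1 <= ln (ln n%:R) :> R.
  by rewrite -[leLHS]expRK ler_ln ?posrE //; lra.
have lnq : ln n%:R <= (2 * q + 8)%:R :> R.
  have : ln n%:R <= ln (2 ^+ (2 * q + 8)) :> R.
    by rewrite ler_ln ?posrE ?exprn_gt0 // -natrX ler_nat.
  rewrite lnXn // => /le_trans; apply.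
  rewrite -[leLHS]mulr_natl ler_piMr //.
  rewrite -[leRHS]expRK ler_ln ?posrE //.
  by have := expR_ge1Dx (1 : R); lra.
have : ln n%:R / ln (ln n%:R) <= ln n%:R :> R.
  by rewrite ler_pdivrMr ?ler_peMr //; lra.
rewrite natrD natrM in lnq.
by lra.
Qed.
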